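(* An $n$-dimensional simplex in spherical geometry with circumradius $R$ and inradius $r$ satisfies $$\tan R\geq n\tan r.$$
   Context: $n$-dimensional spherical space is modeled by the unit sphere in $\mathbb{R}^{n+1}$. An $n$-dimensional spherical simplex is nondegenerate: it has $n+1$ linearly independent unit vectors as vertices and consists of the points of the unit sphere that are nonnegative linear combinations of the vertices. Its circumradius $R<\pi/2$ is the spherical (geodesic) radius of the sphere through all vertices, and its inradius $r$ is the spherical radius of the inscribed sphere, tangent to all facets. *)

(* Defs.v *)
From mathcomp Require Import all_boot all_order all_algebra.
From mathcomp Require Import all_classical all_reals all_analysis.

Set Implicit Arguments.
Unset Strict Implicit.
Unset Printing Implicit Defensive.

Import Order.TTheory GRing.Theory Num.Theory.

Local Open Scope classical_set_scope.
Local Open Scope ring_scope.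

(* Euclidean inner product; the library norm `|x| on matrices is the sup norm
   and is not used here. *)
Definition dot (K : realType) (d : nat) (x y : 'rV[K]_d) : K :=
  \sum_(i < d) x ord0 i * y ord0 i.

Definition unit_sphere (K : realType) (d : nat) : set 'rV[K]_d :=
  [set x | dot x x = 1].

(* Geodesic distance; meaningful for points of the unit sphere only. *)
Definition sdist (K : realType) (d : nat) (x y : 'rV[K]_d) : K :=
  acos (dot x y).

Definition ssphere (K : realType) (d : nat) (c : 'rV[K]_d) (s : K) :
    set 'rV[K]_d :=
  [set x | unit_sphere x /\ sdist c x = s].

Definition sball (K : realType) (d : nat) (c : 'rV[K]_d) (s : K) :
    set 'rV[K]_d :=
  [set x | unit_sphere x /\ sdist c x <= s].

(* Unit vectors that are nonnegative combinations of the rows of V. *)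
Definition spherical_hull (K : realType) (m d : nat) (V : 'M[K]_(m, d)) :
    set 'rV[K]_d :=
  [set x | unit_sphere x /\
     exists a : 'rV[K]_m, (forall i, 0 <= a ord0 i) /\ x = a *m V].

(* The n+1 rows of V are the vertices; the simplex itself is
   [spherical_hull V] and its facet opposite to vertex i is
   [spherical_hull (row' i V)]. *)
Definition spherical_simplex (K : realType) (n : nat) (V : 'M[K]_n.+1) : Prop :=
  (forall i, unit_sphere (row i V)) /\ row_free V.

(* The set of points at distance s from c is also the set of points at distance
   pi - s from -c; the bound s < pi / 2 selects one of the two radii. *)
Definition is_circumradius (K : realType) (n : nat) (V : 'M[K]_n.+1) (s : K) :
    Prop :=
  s < pi / 2 /\
  exists2 c : 'rV[K]_n.+1, unit_sphere c &
    forall i, ssphere c s (row i V).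

(* Tangency at a common point q, as equality of tangent spaces at q: that of
   the facet consists of the w orthogonal to q in the span of its vertices,
   that of the sphere consists of the w orthogonal to both q and c. *)
Definition tangent_to_facet (K : realType) (n : nat) (V : 'M[K]_n.+1)
    (c : 'rV[K]_n.+1) (s : K) (i : 'I_n.+1) : Prop :=
  exists q : 'rV[K]_n.+1,
    [/\ spherical_hull (row' i V) q,
        ssphere c s q &
        forall w : 'rV[K]_n.+1, dot w q = 0 ->
          ((w <= row' i V)%MS <-> dot w c = 0)].

Definition is_inradius (K : realType) (n : nat) (V : 'M[K]_n.+1) (s : K) :
    Prop :=
  exists2 c : 'rV[K]_n.+1, unit_sphere c &
    sball c s `<=` spherical_hull V /\
    forall i, tangent_to_facet V c s i.

(* Main.v *)
Require Import Defs.
From mathcomp Require Import all_boot all_order all_algebra.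
From mathcomp Require Import all_classical all_reals all_analysis.
From mathcomp Require Import ring lra.

Import Order.TTheory GRing.Theory Num.Theory.

Local Open Scope ring_scope.

(** The inequality is Euler's inequality R >= n r for a Euclidean simplex,
transported by the central projection from the origin onto the hyperplane
tangent to the sphere at the circumcentre p.  That projection sends the
simplex to a Euclidean simplex of circumradius tan R, and it sends the
inscribed ball to an ellipsoid none of whose semi-axes is shorter than tan r,
so the image simplex contains a Euclidean ball of radius tan r.

The proof carries this out with the basis w_i dual to the vertices v_i.  The
barycentric coordinates on the tangent hyperplane are, up to the factor cos R,
the functionals given by the w_i, and their gradients are, up to the same
factor, the tangential parts g_i = w_i - (p.w_i) p.  Two estimates of the sum of the |g_i| combine.

- The circumscribed sphere bounds it below.  The sum of the g_i.x_i, where x_i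
  is the tangential part of v_i, equals n, the trace of the identity of the
  tangent space, because the tensors g_i (x) x_i add up to that identity.
  As |x_i| = sin R, Cauchy-Schwarz gives n <= sin R * sum |g_i|
  ([dim_le_sum_tangential]).

- The inscribed sphere bounds it above.  Tangency means that the incentre c is
  at height sin r above each facet: c.w_i = sin r * |w_i| ([tangent_dot]).
  The sums of the w_i and of the |w_i| are then known, because cos R times
  the sum of the w_i is p, and the facetwise inequality [tangential_bound]
  adds up to cos R * sin r * sum |g_i| <= cos r ([sum_tangential_le]).

Together they give n * sin r * cos R <= sin R * cos r. *)

(** * Inner product and Euclidean norm *)

Lemma dotE {K : realType} {d : nat} (x y : 'rV[K]_d) :
  dot x y = (x *m y^T) ord0 ord0.
Proof. by rewrite /dot mxE; apply: eq_bigr => i _; rewrite mxE. Qed.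

Lemma dotC {K : realType} {d : nat} (x y : 'rV[K]_d) : dot x y = dot y x.
Proof. by apply: eq_bigr => i _; rewrite mulrC. Qed.

Lemma dotZl {K : realType} {d : nat} (a : K) (x y : 'rV[K]_d) :
  dot (a *: x) y = a * dot x y.
Proof. by rewrite !dotE -scalemxAl mxE. Qed.

Lemma dotBl {K : realType} {d : nat} (x y z : 'rV[K]_d) :
  dot (x - y) z = dot x z - dot y z.
Proof. by rewrite !dotE mulmxBl !mxE. Qed.

Lemma dotBr {K : realType} {d : nat} (x y z : 'rV[K]_d) :
  dot x (y - z) = dot x y - dot x z.
Proof. by rewrite dotC dotBl !(dotC _ x). Qed.

Lemma dotZr {K : realType} {d : nat} (a : K) (x y : 'rV[K]_d) :
  dot x (a *: y) = a * dot x y.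
Proof. by rewrite dotC dotZl dotC. Qed.

Lemma dot_suml {K : realType} {d m : nat} (f : 'I_m -> 'rV[K]_d)
    (y : 'rV[K]_d) :
  dot (\sum_i f i) y = \sum_i dot (f i) y.
Proof.
rewrite dotE mulmx_suml summxE.
by apply: eq_bigr => i _; rewrite dotE.
Qed.

Lemma dot_ge0 {K : realType} {d : nat} (x : 'rV[K]_d) : 0 <= dot x x.
Proof. by apply: sumr_ge0 => i _; rewrite -expr2 sqr_ge0. Qed.

Lemma dot_eq0 {K : realType} {d : nat} (x : 'rV[K]_d) :
  dot x x = 0 -> x = 0.
Proof.
move=> x0; apply/rowP => i; rewrite mxE; apply/eqP.
rewrite -sqrf_eq0 expr2; apply/eqP; move: i (erefl true).
by apply/psumr_eq0P => // i _; rewrite -expr2 sqr_ge0.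
Qed.

Lemma dot0r {K : realType} {d : nat} (x : 'rV[K]_d) : dot x 0 = 0.
Proof. by rewrite dotE trmx0 mulmx0 mxE. Qed.

Lemma sqr_dot_le {K : realType} {d : nat} (x y : 'rV[K]_d) :
  dot x y ^+ 2 <= dot x x * dot y y.
Proof.
have [y0|yN0] := eqVneq (dot y y) 0.
  by rewrite (dot_eq0 _ y0) !dot0r mulr0 expr0n.
have y_gt0 : 0 < dot y y by rewrite lt_def yN0 dot_ge0.
have := dot_ge0 (dot y y *: x - dot x y *: y).
rewrite !(dotBl, dotBr, dotZl, dotZr) (dotC y x) => H.
rewrite -subr_ge0 -(pmulr_rge0 _ y_gt0).
by apply: le_trans H _; lra.
Qed.

Definition enorm {K : realType} {d : nat} (x : 'rV[K]_d) : K :=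
  Num.sqrt (dot x x).

Lemma enorm_ge0 {K : realType} {d : nat} (x : 'rV[K]_d) : 0 <= enorm x.
Proof. exact: sqrtr_ge0. Qed.

Lemma sqr_enorm {K : realType} {d : nat} (x : 'rV[K]_d) :
  enorm x ^+ 2 = dot x x.
Proof. by rewrite sqr_sqrtr // dot_ge0. Qed.

Lemma dot_le_enorm {K : realType} {d : nat} (x y : 'rV[K]_d) :
  dot x y <= enorm x * enorm y.
Proof.
apply: le_trans (ler_norm _) _.
rewrite -(@ler_pXn2r _ 2) // ?nnegrE ?mulr_ge0 ?enorm_ge0 ?normr_ge0 //.
by rewrite real_normK ?num_real // exprMn !sqr_enorm sqr_dot_le.
Qed.

Lemma dot_unit_itv {K : realType} {d : nat} (x y : 'rV[K]_d) :
  dot x x = 1 -> dot y y = 1 -> -1 <= dot x y <= 1.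
Proof.
move=> x1 y1; rewrite -ler_norml -(@ler_pXn2r _ 2) // ?nnegrE ?normr_ge0 //.
by rewrite real_normK ?num_real // (le_trans (sqr_dot_le _ _)) // x1 y1 mulr1 expr1n.
Qed.

Lemma ssphere_radius {K : realType} {d : nat} (c x : 'rV[K]_d) (s : K) :
  dot c c = 1 -> ssphere c s x ->
  [/\ dot x x = 1, dot c x = cos s & 0 <= s <= pi].
Proof.
move=> c1 [x1 <-].
have cx := dot_unit_itv c x c1 x1.
by split; rewrite ?acosK ?in_itv //= ?acos_ge0 ?acos_lepi.
Qed.

(** * The basis dual to the vertices *)

(** Row i is orthogonal to the facet opposite to vertex i, on the side of that
vertex, and its length is the inverse of the distance from the vertex to the
hyperplane of the facet. *)
Definition dual_basis {K : realType} {n : nat} (V : 'M[K]_n) : 'M[K]_n :=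
  (invmx V)^T.

Lemma dual_coord {K : realType} {n : nat} (V : 'M[K]_n) (y : 'rV[K]_n)
    (i : 'I_n) :
  dot y (row i (dual_basis V)) = (y *m invmx V) ord0 i.
Proof. by rewrite /dot mxE; apply: eq_bigr => j _; rewrite !mxE. Qed.

Lemma dual_expansion {K : realType} {n : nat} (V : 'M[K]_n) (y : 'rV[K]_n) :
  V \in unitmx -> y = \sum_i dot y (row i V) *: row i (dual_basis V).
Proof.
move=> Vu; rewrite -[LHS]mulmx1 -trmx1 -(mulVmx Vu) trmx_mul mulmxA.
rewrite mulmx_sum_row; apply: eq_bigr => i _; congr (_ *: _).
by rewrite dotE !mxE; apply: eq_bigr => j _; rewrite !mxE.
Qed.

Lemma dual_dot {K : realType} {n : nat} (V : 'M[K]_n) (i j : 'I_n) :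
  V \in unitmx -> dot (row i V) (row j (dual_basis V)) = (i == j)%:R.
Proof. by move=> Vu; rewrite dual_coord -row_mul mulmxV // !mxE. Qed.

Lemma dual_facet {K : realType} {n : nat} (V : 'M[K]_n.+1) (i : 'I_n.+1)
    (y : 'rV[K]_n.+1) :
  V \in unitmx ->
  (y <= row' i V)%MS <-> dot y (row i (dual_basis V)) = 0.
Proof.
move=> Vu; split=> [/submxP[a ->]|y0].
  rewrite mulmx_sum_row dot_suml big1 // => j _.
  by rewrite dotZl row_rowsub dual_dot // eq_sym (negPf (neq_lift _ _)) mulr0.
rewrite -[y](mulmxKV Vu) mulmx_sum_row; apply: summx_sub => j _.
case: (unliftP i j) => [k ->|->]; last by rewrite -dual_coord y0 scale0r sub0mx.
by rewrite scalemx_sub // -row_rowsub row_sub.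
Qed.

Lemma hull_dual_ge0 {K : realType} {n : nat} (V : 'M[K]_n) (y : 'rV[K]_n)
    (i : 'I_n) :
  V \in unitmx -> spherical_hull V y -> 0 <= dot y (row i (dual_basis V)).
Proof. by move=> Vu [_ [a [a_ge0 ->]]]; rewrite dual_coord mulmxK. Qed.

(** * Tangency to a facet *)

(** Removing from the centre c its components along the contact point q and
along the normal w of the facet leaves a vector of the facet hyperplane
orthogonal to q.  By tangency it is orthogonal to c as well, so c lies in the
plane of q and w; since c.q = cos s, its component along w has length sin s. *)
Lemma tangent_dot {K : realType} {n : nat} (V : 'M[K]_n.+1)
    (c : 'rV[K]_n.+1) (s : K) (i : 'I_n.+1) :
  V \in unitmx -> dot c c = 1 ->
  0 <= dot c (row i (dual_basis V)) -> tangent_to_facet V c s i ->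
  [/\ dot c (row i (dual_basis V)) = sin s * enorm (row i (dual_basis V))
    & 0 <= s <= pi].
Proof.
move=> Vu c1 cw_ge0 [q [[_ [a [_ qE]]] qs qT]].
have [q1 cq s_itv] := ssphere_radius c q s c1 qs.
set w := row i _ in cw_ge0 *.
have qw : dot q w = 0 by apply/dual_facet => //; rewrite qE submxMl.
have wN0 : dot w w != 0.
  apply/eqP => /dot_eq0 w0; have := dual_dot V i i Vu.
  by rewrite -/w w0 dot0r eqxx => /esym/eqP; rewrite oner_eq0.
split=> //.
pose x := c - dot c q *: q - (dot c w / dot w w) *: w.
have xq : dot x q = 0.
  by rewrite !(dotBl, dotZl) q1 (dotC w q) qw; ring.
have xw : dot x w = 0.
  by rewrite !(dotBl, dotZl) qw; field.
have /(qT x xq) : (x <= row' i V)%MS by apply/dual_facet.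
rewrite !(dotBl, dotZl) c1 (dotC q c) (dotC w c) cq => H.
have {}H : dot c w ^+ 2 = (sin s * enorm w) ^+ 2.
  rewrite exprMn sqr_enorm sin2cos2.
  have -> : 1 - cos s ^+ 2 = dot c w / dot w w * dot c w by move: H; lra.
  by field.
apply/eqP; rewrite -(@eqrXn2 _ 2) ?H //.
by rewrite mulr_ge0 ?enorm_ge0 // sin_ge0_pi.
Qed.

(** * The two bounds on the barycentric gradients *)

(** Here g = p.c and s = sin r, while W = |w|, m = p.w and G = |w - m p| for a
facet normal w and a = cos r.  For g > s the cone over the inscribed ball cuts
the tangent hyperplane at p in an ellipsoid with centre
z = (g c - s^2 p) / (g^2 - s^2).  When c.w = s W the distance from z to the
facet is (w.z) / G = s (g W - s m) / ((g^2 - s^2) G), and the inequality says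
that it is at least s / a = tan r.  It follows by squaring from 1 - s^2 >=
g^2 - s^2 and the identity
(g W - s m)^2 = (s W - g m)^2 + (g^2 - s^2) (W^2 - m^2). *)
Lemma tangential_bound {K : realType} (g s a W m G : K) :
  0 <= s -> s <= g -> g <= 1 -> 0 <= a -> a ^+ 2 = 1 - s ^+ 2 ->
  0 <= G -> G ^+ 2 = W ^+ 2 - m ^+ 2 -> m <= W -> 0 <= W ->
  (g ^+ 2 - s ^+ 2) * G <= a * (g * W - s * m).
Proof.
move=> s0 sg g1 a0 a2 G0 G2 mW W0.
have D0 : 0 <= g ^+ 2 - s ^+ 2 by nra.
have E0 : 0 <= g * W - s * m by nra.
rewrite -(@ler_pXn2r _ 2) // ?nnegrE ?mulr_ge0 //.
rewrite !exprMn a2 G2.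
have H1 : (g * W - s * m) ^+ 2 =
    (s * W - g * m) ^+ 2 + (g ^+ 2 - s ^+ 2) * (W ^+ 2 - m ^+ 2) by ring.
have P0 : 0 <= W ^+ 2 - m ^+ 2 by rewrite -G2 sqr_ge0.
apply: (@le_trans _ _ ((1 - s ^+ 2) * ((g ^+ 2 - s ^+ 2) * (W ^+ 2 - m ^+ 2)))).
  rewrite expr2 -mulrA ler_wpM2r ?mulr_ge0 //; nra.
by rewrite H1 ler_wpM2l -?a2 ?sqr_ge0 // lerDr sqr_ge0.
Qed.

Definition tangential {K : realType} {d : nat} (p w : 'rV[K]_d) : 'rV[K]_d :=
  w - dot p w *: p.

Lemma sqr_enorm_tangential {K : realType} {d : nat} (p w : 'rV[K]_d) :
  dot p p = 1 -> enorm (tangential p w) ^+ 2 = enorm w ^+ 2 - dot p w ^+ 2.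
Proof.
move=> p1; rewrite !sqr_enorm /tangential !(dotBl, dotBr, dotZl, dotZr) p1.
by rewrite (dotC w p); ring.
Qed.

(** The functional p takes the value k on the whole basis V, hence it is k
times the sum of the coordinate functionals of V. *)
Lemma equidistant_dual_sum {K : realType} {n : nat} (V : 'M[K]_n)
    (p y : 'rV[K]_n) (k : K) :
  V \in unitmx -> (forall i, dot p (row i V) = k) ->
  k * \sum_i dot y (row i (dual_basis V)) = dot p y.
Proof.
move=> Vu pv; rewrite mulr_sumr [in RHS](dual_expansion V p Vu) dot_suml.
by apply: eq_bigr => i _; rewrite dotZl pv (dotC _ y).
Qed.

(** The tangential parts of v_i and of its dual vector w_i have product
1 - k (p.w_i), and these numbers add up to (n + 1) - p.p = n.  Each of them is
at most the product of the norms, the first of which is always t. *)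
Lemma dim_le_sum_tangential {K : realType} {n : nat} (V : 'M[K]_n.+1)
    (p : 'rV[K]_n.+1) (k t : K) :
  V \in unitmx -> (forall i, dot (row i V) (row i V) = 1) -> dot p p = 1 ->
  (forall i, dot p (row i V) = k) -> 0 <= t -> t ^+ 2 = 1 - k ^+ 2 ->
  n%:R <= t * \sum_i enorm (tangential p (row i (dual_basis V))).
Proof.
move=> Vu v1 p1 pv t_ge0 t2.
have -> : n%:R = \sum_(i < n.+1) (1 - k * dot p (row i (dual_basis V))).
  rewrite sumrB -mulr_sumr (equidistant_dual_sum _ _ p _ Vu pv) p1.
  by rewrite sumr_const card_ord -addn1 natrD addrK.
rewrite mulr_sumr; apply: ler_sum => i _.
set w := row i _.
have xE : enorm (tangential p (row i V)) = t.
  apply/eqP; rewrite -(@eqrXn2 _ 2) ?enorm_ge0 // sqr_enorm_tangential //.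
  by rewrite sqr_enorm v1 pv t2.
rewrite -xE; apply: le_trans (dot_le_enorm _ _).
rewrite /tangential !(dotBl, dotBr, dotZl, dotZr) p1 pv (dotC _ p) pv.
by rewrite dual_dot // eqxx /=; lra.
Qed.

(** Summing [tangential_bound] over the facets gives the bound multiplied by
(p.c)^2 - s^2.  If this factor vanishes, the triangle inequality for the sum
of the w_i is an equality, so every w_i is a multiple of p and the left-hand
side is zero. *)
Lemma sum_tangential_le {K : realType} {n : nat} (V : 'M[K]_n)
    (p c : 'rV[K]_n) (k s a : K) :
  V \in unitmx -> dot p p = 1 -> dot c c = 1 ->
  (forall i, dot p (row i V) = k) -> 0 < k ->
  (forall i, dot c (row i (dual_basis V)) = s * enorm (row i (dual_basis V))) ->
  0 < s -> 0 <= a -> a ^+ 2 = 1 - s ^+ 2 ->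
  k * s * \sum_i enorm (tangential p (row i (dual_basis V))) <= a.
Proof.
move=> Vu p1 c1 pv k_gt0 cw s_gt0 a_ge0 a2.
pose W i := enorm (row i (dual_basis V)).
pose m i := dot p (row i (dual_basis V)).
pose G i := enorm (tangential p (row i (dual_basis V))).
rewrite -/(\sum_i G i).
have sum_m : k * \sum_i m i = 1 by rewrite -p1; exact: equidistant_dual_sum.
have sum_W : k * s * \sum_i W i = dot p c.
  rewrite -(equidistant_dual_sum _ _ c _ Vu pv) -mulrA; congr (_ * _).
  by rewrite mulr_sumr; apply: eq_bigr => i _; rewrite cw.
have G2 i : G i ^+ 2 = W i ^+ 2 - m i ^+ 2 by exact: sqr_enorm_tangential.
have mW i : m i <= W i.
  by rewrite (le_trans (dot_le_enorm _ _)) // {1}/enorm p1 sqrtr1 mul1r.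
have sum_mW : \sum_i m i <= \sum_i W i by apply: ler_sum.
have sE : s = k * s * \sum_i m i by rewrite -mulrA mulrCA sum_m mulr1.
have s_le : s <= dot p c.
  by rewrite -sum_W {1}sE ler_pM2l ?mulr_gt0.
have /andP[_ c_le1] := dot_unit_itv p c p1 c1.
have [s_eq|s_neq] := eqVneq s (dot p c).
  have /psumr_eq0P Wm0 : forall i, true -> 0 <= W i - m i.
    by move=> i _; rewrite subr_ge0.
  have sum_Wm : \sum_i (W i - m i) = 0.
    apply: (@mulfI _ (k * s)); first by rewrite mulf_neq0 ?gt_eqF.
    by rewrite sumrB mulrBr mulr0 sum_W -sE -s_eq subrr.
  rewrite big1 ?mulr0 // => i _; apply/eqP; rewrite -sqrf_eq0 G2.
  by rewrite -(subr0_eq (Wm0 sum_Wm i isT)) subrr.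
have s_lt : s < dot p c by rewrite lt_def eq_sym s_neq.
have D_gt0 : 0 < dot p c ^+ 2 - s ^+ 2.
  by rewrite subr_gt0 ltrXn2r // ?ltW // (lt_trans s_gt0).
rewrite -(ler_pM2l D_gt0).
have : \sum_i (dot p c ^+ 2 - s ^+ 2) * G i <=
       \sum_i a * (dot p c * W i - s * m i).
  apply: ler_sum => i _.
  by apply: tangential_bound; rewrite ?enorm_ge0 // ltW.
rewrite -!mulr_sumr sumrB -!mulr_sumr => H.
have {H} := ler_wpM2l (ltW (mulr_gt0 k_gt0 s_gt0)) H.
have -> : k * s * (a * (dot p c * \sum_i W i - s * \sum_i m i)) =
    a * (dot p c * (k * s * \sum_i W i) - s * (k * s * \sum_i m i)) by ring.
by rewrite sum_W -sE; lra.
Qed.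

(** * The inequality *)

Theorem theorem4p2 (K : realType) (n : nat) (V : 'M[K]_n.+1) (R r : K) :
  spherical_simplex V ->
  is_circumradius V R ->
  is_inradius V r ->
  n%:R * tan r <= tan R.
Proof.
move=> [v1 Vf] [R_lt [p p1 pV]] [c c1 [ball_in cT]].
have Vu : V \in unitmx by rewrite -row_free_unit.
have pRow i : [/\ dot (row i V) (row i V) = 1, dot p (row i V) = cos R
    & 0 <= R <= pi] := ssphere_radius p _ R p1 (pV i).
have pv i : dot p (row i V) = cos R by case: (pRow i).
have /andP[R_ge0 R_le] : 0 <= R <= pi by case: (pRow ord0).
have cosR : 0 < cos R.
  rewrite cos_gt0_pihalf // R_lt andbT (lt_le_trans _ R_ge0) //.
  by rewrite oppr_lt0 divr_gt0 ?pi_gt0.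
have sinR : 0 <= sin R by rewrite sin_ge0_pi // R_ge0.
have tanR : 0 <= tan R by rewrite /tan divr_ge0 // ltW.
have r_ge0 : 0 <= r.
  have [q [_ qs _]] := cT ord0.
  by have [_ _ /andP[]] := ssphere_radius c q r c1 qs.
have c_in : spherical_hull V c.
  by apply: ball_in; split; rewrite // /sdist c1 acos1.
have cw i := tangent_dot V c r i Vu c1 (hull_dual_ge0 V c i Vu c_in) (cT i).
have sinr : 0 <= sin r by have [_ r_itv] := cw ord0; rewrite sin_ge0_pi.
(* A priori r ranges over [0, pi]; beyond pi / 2 its tangent is nonpositive. *)
have [tanr|tanr] := leP (tan r) 0.
  by rewrite (le_trans _ tanR) // mulr_ge0_le0.
have sinr_gt0 : 0 < sin r.
  rewrite lt_def sinr andbT; apply: contraTneq tanr => s0.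
  by rewrite /tan s0 mul0r ltxx.
have cosr_gt0 : 0 < cos r by move: tanr; rewrite /tan pmulr_rgt0 // invr_gt0.
have dim_le := dim_le_sum_tangential V p (cos R) (sin R) Vu v1 p1 pv sinR
  (sin2cos2 R).
have sum_le := sum_tangential_le V p c (cos R) (sin r) (cos r) Vu p1 c1 pv
  cosR (fun i => let: conj e _ := cw i in e) sinr_gt0 (ltW cosr_gt0)
  (cos2sin2 r).
rewrite /tan mulrA ler_pdivrMr // mulrAC ler_pdivlMr //.
have := ler_wpM2l sinR sum_le.
have := ler_wpM2r (ltW (mulr_gt0 cosR sinr_gt0)) dim_le.
lra.
Qed.
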